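(* Let $A$ be a unital prime $C^*$-algebra with nonzero socle and let $u\in A^\wedge$. (1) If, for every $a,b\in A$, $a\leq_\diamond b$ holds if and only if $au\leq_\diamond bu$, then $uu^*=\lambda\mathbf{1}$ for some real number $\lambda>0$. (2) If, for every $a,b\in A$, $a\leq_\diamond b$ holds if and only if $ua\leq_\diamond ub$, then $u^*u=\lambda\mathbf{1}$ for some real number $\lambda>0$.
   Context: All algebras are complex; $\mathbf{1}$ denotes the identity element. For elements $a,b$ of a unital $C^*$-algebra $A$, the diamond relation is defined by: $a\leq_\diamond b$ if and only if $aA\subseteq bA$, $Aa\subseteq Ab$ and $aa^*a=ab^*a$. $A^\wedge$ is the set of (von Neumann) regular elements of $A$, i.e. those $a\in A$ for which there is $c\in A$ with $a=aca$. The socle of $A$ is the sum of all minimal left ideals (equivalently, of all minimal right ideals) of $A$. *)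

(* Defs.v *)
From HB Require Import structures.
From mathcomp Require Import all_boot all_order all_algebra.
From mathcomp Require Export complex.
From mathcomp Require Import boolp classical_sets reals.

Set Implicit Arguments.
Unset Strict Implicit.
Unset Printing Implicit Defensive.

Import Order.TTheory GRing.Theory Num.Theory.

Local Open Scope classical_set_scope.
Local Open Scope ring_scope.
Local Open Scope complex_scope.

(* Hierarchy-Builder rejects a structure joining [algType] with the normed types
   of the library (the join would have to precede [Num.NumDomain]), so the norm
   and its completeness are fields here.  The algebra is unital because [algType]
   is; nonnegativity of the norm follows from [cnormZ] and [ler_cnormD]. *)
HB.mixin Record Algebra_isCStarAlgebra (R : realType) A of GRing.Algebra R[i] A := {
  cnorm : A -> R ;
  cnorm0_eq0 : forall x : A, cnorm x = 0 -> x = 0 ;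
  cnormZ : forall (c : R[i]) (x : A), cnorm (c *: x) = Normc.normc c * cnorm x ;
  ler_cnormD : forall x y : A, cnorm (x + y) <= cnorm x + cnorm y ;
  ler_cnormM : forall x y : A, cnorm (x * y) <= cnorm x * cnorm y ;
  cnorm_complete : forall s : nat -> A,
    (forall e : R, 0 < e -> exists N : nat, forall m n : nat,
       (N <= m)%N -> (N <= n)%N -> cnorm (s m - s n) < e) ->
    exists l : A, forall e : R, 0 < e -> exists N : nat, forall n : nat,
       (N <= n)%N -> cnorm (s n - l) < e ;
  star : A -> A ;
  starK : involutive star ;
  starD : forall x y : A, star (x + y) = star x + star y ;
  starZ : forall (c : R[i]) (x : A), star (c *: x) = c^* *: star x ;
  starM : forall x y : A, star (x * y) = star y * star x ;
  cnorm_starM : forall x : A, cnorm (star x * x) = cnorm x ^+ 2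
}.

#[short(type="cstarAlgType")]
HB.structure Definition CStarAlgebra (R : realType) :=
  {A of GRing.Algebra R[i] A & Algebra_isCStarAlgebra R A}.

Notation "x ^star" := (star x) (at level 1, format "x ^star") : ring_scope.

Section RingNotions.
Variable A : nzRingType.

Definition prime_ring :=
  forall a b : A, (forall x, a * x * b = 0) -> a = 0 \/ b = 0.

Definition vN_regular (a : A) := exists c, a = a * c * a.

Definition principal_right_ideal (a : A) : set A := [set a * x | x in setT].

Definition principal_left_ideal (a : A) : set A := [set x * a | x in setT].

(* No scalar multiplication is required: in a unital algebra [c *: x] is
   [c%:A * x]. *)
Definition left_ideal (I : set A) :=
  [/\ I 0, forall x y, I x -> I y -> I (x + y) & forall a x, I x -> I (a * x)].

Definition minimal_left_ideal (I : set A) :=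
  [/\ left_ideal I, I <> [set 0] &
      forall J, left_ideal J -> J `<=` I -> J = [set 0] \/ J = I].

Definition socle : set A :=
  [set x | exists (n : nat) (I : 'I_n -> set A) (y : 'I_n -> A),
     (forall i, minimal_left_ideal (I i) /\ I i (y i)) /\ x = \sum_(i < n) y i].

End RingNotions.

Arguments socle : clear implicits.

Definition diamond_le (R : realType) (A : cstarAlgType R) (a b : A) :=
  [/\ principal_right_ideal a `<=` principal_right_ideal b,
      principal_left_ideal a `<=` principal_left_ideal b
    & a * a^star * a = a * b^star * a].

(* Main.v *)
(** Write [h = u u^*].  If [a^2 = 0] then [a - 1] is invertible and [a <= a - 1]
    for the diamond order, so [a u <= (a - 1) u], which amounts to [a h a = 0].
    In a prime ring this forces [h] to commute with every idempotent.  The socle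
    provides a projection [p] for which [p A p] is a division algebra, and the
    C*-identity, in place of spectral theory, gives [p A p = C p]: a self-adjoint
    [g] with [|g| = 1] satisfies [|prod_(j < m) (1 + g^(2^(j+1)))| >= 2^m], hence
    [1 - g^2] is not invertible.  Then [h p = l p], and as [h] commutes with the
    idempotents [p + (1 - p) x p], the element [h - l] kills [A p], so that
    [h = l].  The second part is the first one applied to [u^*]. *)
Require Import Defs.
From mathcomp Require Import all_boot all_order all_algebra.
From mathcomp Require Import boolp classical_sets reals.

Set Implicit Arguments.
Unset Strict Implicit.
Unset Printing Implicit Defensive.

Import Order.TTheory GRing.Theory Num.Theory.
Local Open Scope classical_set_scope.
Local Open Scope ring_scope.
Local Open Scope complex_scope.

(** * Elementary identities for the involution and the norm *)

Lemma conjI (R : realType) : Num.conj ('i%C : R[i]) = - 'i%C.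
Proof. by apply/eqP; rewrite eq_complex /= oppr0 !eqxx. Qed.

Lemma normcR_ge0 (R : realType) (r : R) : 0 <= r -> Normc.normc r%:C = r.
Proof. by move=> r0; rewrite /= expr0n addr0 sqrtr_sqr ger0_norm. Qed.

Lemma normcN1 (R : realType) : Normc.normc (-1 : R[i]) = 1.
Proof. by rewrite normcN Normc.normc1. Qed.

Lemma star0 (R : realType) (A : cstarAlgType R) : (0 : A)^star = 0.
Proof. by apply: (addIr (0 : A)^star); rewrite -starD !add0r. Qed.

Lemma starN (R : realType) (A : cstarAlgType R) (x : A) :
  (- x)^star = - x^star.
Proof. by apply/eqP; rewrite -addr_eq0 -starD addNr star0. Qed.

Lemma starB (R : realType) (A : cstarAlgType R) (x y : A) :
  (x - y)^star = x^star - y^star.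
Proof. by rewrite starD starN. Qed.

Lemma star1 (R : realType) (A : cstarAlgType R) : (1 : A)^star = 1.
Proof. by rewrite -[LHS]mul1r -{1}[1]starK -starM mul1r starK. Qed.

Lemma starX (R : realType) (A : cstarAlgType R) (x : A) n :
  (x ^+ n)^star = x^star ^+ n.
Proof.
elim: n => [|n IH]; first by rewrite !expr0 star1.
by rewrite exprS exprSr starM IH.
Qed.

Lemma starI (R : realType) (A : cstarAlgType R) (x : A) :
  ('i%C *: x)^star = - ('i%C *: x^star).
Proof. by rewrite starZ conjI scaleNr. Qed.

Lemma starZR (R : realType) (A : cstarAlgType R) (r : R) (x : A) :
  (r%:C *: x)^star = r%:C *: x^star.
Proof. by rewrite starZ [Num.conj _]conjc_real. Qed.

Lemma cnorm0 (R : realType) (A : cstarAlgType R) : cnorm (0 : A) = 0.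
Proof. by rewrite -(scale0r (0 : A)) cnormZ Normc.normc0 mul0r. Qed.

Lemma cnormN (R : realType) (A : cstarAlgType R) (x : A) :
  cnorm (- x) = cnorm x.
Proof. by rewrite -scaleN1r cnormZ normcN1 mul1r. Qed.

Lemma ler_cnormB (R : realType) (A : cstarAlgType R) (x y : A) :
  cnorm (x - y) <= cnorm x + cnorm y.
Proof. by rewrite -(cnormN y) ler_cnormD. Qed.

Lemma cnormMn (R : realType) (A : cstarAlgType R) (x : A) n :
  cnorm (x *+ n) = cnorm x *+ n.
Proof.
by rewrite -scaler_nat cnormZ -(rmorph_nat (real_complex R)) normcR_ge0
  ?ler0n // mulr_natl.
Qed.

Lemma cnorm_ge0 (R : realType) (A : cstarAlgType R) (x : A) : 0 <= cnorm x.
Proof.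
have := ler_cnormB x x.
by rewrite subrr cnorm0 -mulr2n pmulrn_lge0.
Qed.

Lemma cnorm_gt0 (R : realType) (A : cstarAlgType R) (x : A) :
  x != 0 -> 0 < cnorm x.
Proof.
move=> x0; rewrite lt_def cnorm_ge0 andbT.
by apply: contra_neq x0; exact: cnorm0_eq0.
Qed.

Lemma star_mul_eq0 (R : realType) (A : cstarAlgType R) (x : A) :
  x^star * x = 0 -> x = 0.
Proof.
move=> xx; apply: cnorm0_eq0; apply/eqP.
by rewrite -sqrf_eq0 -cnorm_starM xx cnorm0.
Qed.

Lemma mul_star_eq0 (R : realType) (A : cstarAlgType R) (x : A) :
  x * x^star = 0 -> x = 0.
Proof.
move=> xx; rewrite -[x]starK (_ : x^star = 0) ?star0 //.
by apply: star_mul_eq0; rewrite starK.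
Qed.

Lemma cnorm_proj (R : realType) (A : cstarAlgType R) (p : A) :
  p != 0 -> p^star = p -> p * p = p -> cnorm p = 1.
Proof.
move=> p0 ps pp; have := cnorm_starM p; rewrite ps pp expr2 => /eqP.
by rewrite -subr_eq0 -{1}[cnorm p]mul1r -mulrBl mulf_eq0
  (gt_eqF (cnorm_gt0 p0)) orbF subr_eq0 => /eqP.
Qed.

(** * Norm estimates for commuting self-adjoint elements *)

Lemma mulDI (R : realType) (A : cstarAlgType R) (a b : A) : a * b = b * a ->
  (a + 'i%C *: b) * (a - 'i%C *: b) = a * a + b * b.
Proof.
move=> ab; rewrite mulrDl !mulrBr -!scalerAl -!scalerAr scalerA -ab.
have -> : 'i%C * 'i%C = -1 :> R[i] by rewrite -expr2 sqr_i.
rewrite scaleN1r opprK addrA; congr (_ + _).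
by rewrite -addrA addNr addr0.
Qed.

(* [a + ib] is normal, so the C*-identity shows that multiplying [z] by it or
   by its adjoint [a - ib] gives the same norm. *)
Lemma cnorm_mulJ (R : realType) (A : cstarAlgType R) (a b z : A) :
    a^star = a -> b^star = b -> a * b = b * a ->
  cnorm ((a - 'i%C *: b) * z) = cnorm ((a + 'i%C *: b) * z).
Proof.
move=> sa sb ab.
have sM : (a - 'i%C *: b)^star = a + 'i%C *: b.
  by rewrite starB starI sa sb opprK.
have sP : (a + 'i%C *: b)^star = a - 'i%C *: b by rewrite -sM starK.
have ab' : a * - b = - b * a by rewrite mulrN ab mulNr.
apply/eqP; rewrite -(eqrXn2 (ltn0Sn 1)) ?cnorm_ge0 // -!cnorm_starM !starM.
rewrite sM sP -!mulrA (mulrA (a + _)) (mulrA (a - _)) mulDI //.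
by have := mulDI ab'; rewrite scalerN opprK mulrNN => ->.
Qed.

(** [2a] is the sum of [a + ib] and [a - ib], and multiplying [z] by either one gives the same
    norm. *)
Lemma le_cnorm_re (R : realType) (A : cstarAlgType R) (a b z : A) :
    a^star = a -> b^star = b -> a * b = b * a ->
  cnorm (a * z) <= cnorm ((a + 'i%C *: b) * z).
Proof.
move=> sa sb ab; rewrite -(@ler_pMn2r _ 2) // -cnormMn mulr2n.
have -> : a * z + a * z = (a + 'i%C *: b) * z + (a - 'i%C *: b) * z.
  by rewrite -!mulrDl addrACA subrr addr0.
apply: (le_trans (ler_cnormD _ _)).
by rewrite cnorm_mulJ // -mulr2n.
Qed.

(** Since [a^2 + b^2] factors as [(a + ib)(a - ib)], the bound by the real part applies once to each
    factor. *)
Lemma le_cnorm_sqr (R : realType) (A : cstarAlgType R) (a b z : A) :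
    a^star = a -> b^star = b -> a * b = b * a ->
  cnorm (a * a * z) <= cnorm ((a * a + b * b) * z).
Proof.
move=> sa sb ab; rewrite -mulDI // -(mulrA (a + _)).
apply: le_trans (le_cnorm_re _ sa sb ab).
have aC : a * (a - 'i%C *: b) = (a - 'i%C *: b) * a.
  by rewrite mulrBr mulrBl -scalerAr -scalerAl ab.
rewrite mulrA aC -!mulrA cnorm_mulJ //; exact: le_cnorm_re.
Qed.

(* [(1 + y^2)^2 = (2y)^2 + (1 - y^2)^2] *)
Lemma le_cnorm_sqr1D (R : realType) (A : cstarAlgType R) (y z : A) :
    y^star = y ->
  cnorm (y ^+ 2 * z) *+ 4 <= cnorm ((1 + y ^+ 2) ^+ 2 * z).
Proof.
move=> sy; have := @le_cnorm_sqr R A (y *+ 2) (1 - y ^+ 2) z.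
have -> : (y *+ 2) * (y *+ 2) = y ^+ 2 *+ 4.
  by rewrite mulrnAl mulrnAr -mulrnA -expr2.
have -> : y ^+ 2 *+ 4 + (1 - y ^+ 2) * (1 - y ^+ 2) = (1 + y ^+ 2) ^+ 2.
  set w := y ^+ 2; rewrite -expr2 -[(1 - w) ^+ 2]sqrrN opprB sqrrB1.
  rewrite [1 + w]addrC sqrrD1 addrA; congr (_ + 1); rewrite addrA.
  by rewrite addrAC -mulrnBr // addrC.
rewrite mulrnAl cnormMn; apply => //.
- by rewrite mulr2n starD sy.
- by rewrite starB star1 starX sy.
- by apply: commrB; [exact: commr1|apply/commrX/commr_sym/commrMn].
Qed.

(** * Non-invertibility of [1 - g^2] for self-adjoint [g] of norm 1 *)

Lemma cnorm_sa_pow2 (R : realType) (A : cstarAlgType R) (g : A) m :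
  g^star = g -> cnorm g = 1 -> cnorm (g ^+ (2 ^ m)) = 1.
Proof.
move=> sg g1; elim: m => [|m IH]; first by rewrite expn0 expr1.
have := cnorm_starM (g ^+ (2 ^ m)).
by rewrite starX sg IH expr1n -exprD addnn -mul2n -expnS.
Qed.

(** The factors are squared so that [le_cnorm_sqr1D] bounds each from below; the product telescopes
    against [(1 - g^2)^2]. *)
Definition sqr_prod (A : pzRingType) (g : A) m : A :=
  \prod_(j < m) (1 + (g ^+ (2 ^ j)) ^+ 2) ^+ 2.

Lemma sqr_prodS (A : pzRingType) (g : A) m :
  sqr_prod g m.+1 = sqr_prod g m * (1 + (g ^+ (2 ^ m)) ^+ 2) ^+ 2.
Proof. exact: big_ord_recr. Qed.

Lemma mul_sqr_prod (A : pzRingType) (g : A) m :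
  (1 - g ^+ 2) ^+ 2 * sqr_prod g m = (1 - (g ^+ (2 ^ m)) ^+ 2) ^+ 2.
Proof.
elim: m => [|m IH]; first by rewrite /sqr_prod big_ord0 mulr1 expn0 expr1.
have cy (w : A) : GRing.comm (1 - w) (1 + w).
  by apply: commrD; [exact: commr1|apply/commr_sym/commrB;
     [exact: commr1|exact: commr_refl]].
rewrite sqr_prodS mulrA IH -exprMn_comm // mulrDr mulr1 mulrBl mul1r.
by rewrite addrA addrNK -!exprM -exprD addnn -muln2 expnSr.
Qed.

(** Each factor contributes a 4 and a power [g^(2^(j+1))]; the exponents [2 + 4 + ... + 2^m] add up
    to [2(2^m - 1)]. The arbitrary [z] absorbs the last factor in the induction. *)
Lemma le_cnorm_sqr_prod (R : realType) (A : cstarAlgType R) (g z : A) m :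
    g^star = g ->
  cnorm (g ^+ (2 ^ m).-1.*2 * z) *+ 4 ^ m <= cnorm (sqr_prod g m * z).
Proof.
move=> sg; elim: m z => [|m IH] z.
  by rewrite /sqr_prod big_ord0 expn0 expr0 mulr1n.
rewrite sqr_prodS -mulrA; apply: le_trans (IH _).
rewrite [(4 ^ _)%N]expnS mulrnA lerMn2r; apply/orP; right.
set y := g ^+ (2 ^ m).
have gy : GRing.comm (g ^+ (2 ^ m).-1.*2) ((1 + y ^+ 2) ^+ 2).
  apply/commrX/commrD; [exact: commr1|apply/commrX].
  by rewrite /GRing.comm -!exprD addnC.
rewrite mulrA gy -mulrA.
apply: le_trans (le_cnorm_sqr1D _ _); last by rewrite starX sg.
rewrite mulrA -exprM -exprD muln2 -doubleD expnS mul2n -(addnn (2 ^ m)).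
by have := expn_gt0 2 m; case: (2 ^ m)%N => // k _; rewrite addnS.
Qed.

(* If [c (1 - g^2) = 1], then [sqr_prod g m] is bounded in norm by a constant
   independent of [m], although it grows at least like [4 ^ m]. *)
Lemma sa_not_linv (R : realType) (A : cstarAlgType R) (g c : A) :
  g^star = g -> cnorm g = 1 -> c * (1 - g ^+ 2) <> 1.
Proof.
move=> sg g1 cg.
have n1 : cnorm (1 : A) = 1.
  by apply: cnorm_proj; rewrite ?oner_eq0 ?star1 ?mulr1.
have bound m : (4 ^ m)%:R <= cnorm (c * c) * 4%:R.
  (* The choice [z = g^2] completes the exponent to [2^(m+1)], where the norm is 1. *)
  have -> : (4 ^ m)%:R = cnorm (g ^+ (2 ^ m).-1.*2 * g ^+ 2) *+ (4 ^ m).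
    rewrite -exprD -(doubleD _ 1) addn1 prednK ?expn_gt0 // -mul2n -expnS.
    by rewrite cnorm_sa_pow2.
  apply: le_trans (le_cnorm_sqr_prod _ _ sg) _.
  have g2 : cnorm (g ^+ 2) = 1 by exact: (cnorm_sa_pow2 1).
  apply: le_trans (ler_cnormM _ _) _; rewrite g2 mulr1.
  have -> : sqr_prod g m = c * c * (1 - (g ^+ (2 ^ m)) ^+ 2) ^+ 2.
    by rewrite -mul_sqr_prod mulrA (expr2 (1 - _)) -(mulrA c) (mulrA c (1 - _))
      cg mul1r cg mul1r.
  apply: le_trans (ler_cnormM _ _) _; apply: (ler_wpM2l (cnorm_ge0 _)).
  have le2 : cnorm (1 - (g ^+ (2 ^ m)) ^+ 2) <= 2.
    apply: le_trans (ler_cnormB _ _) _.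
    by rewrite -exprM -expnSr cnorm_sa_pow2 // n1 -mulr2n.
  rewrite expr2; apply: le_trans (ler_cnormM _ _) _.
  by rewrite (natrM _ 2 2) ler_pM ?cnorm_ge0.
have K0 : 0 <= cnorm (c * c) * 4%:R by rewrite mulr_ge0 ?cnorm_ge0.
have := archi_boundP K0; set n := Num.bound _ => lt_n.
have /lt_le_trans := lt_n => /(_ (4 ^ n)%:R).
rewrite ler_nat => /(_ (ltnW (ltn_expl n (isT : (1 < 4)%N)))).
by rewrite ltNge bound.
Qed.

(** * Idempotents in a prime ring *)

Lemma idemC (A : pzRingType) (f : A) : f * f = f -> (1 - f) * (1 - f) = 1 - f.
Proof. by move=> ff; rewrite mulrBr mulr1 mulrBl mul1r ff subrr subr0. Qed.

(* Polarizing [y h y = 0] over [y] in [f A (1 - f)] shows that [y h y' h y'']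
   is alternating; since [y' h y''] lies in [f A (1 - f)] as well, the cyclic
   permutation, which is even, must also change the sign. *)
Lemma corner_idem0 (A : nzRingType) (h f : A) :
    prime_ring A -> (forall x : A, x *+ 2 = 0 -> x = 0) ->
    (forall a, a * a = 0 -> a * h * a = 0) -> f * f = f ->
  (1 - f) * h * f = 0.
Proof.
move=> A_prime two_reg h_nil ff; set k := 1 - f.
have kk : k * k = k by exact: idemC.
have kf : k * f = 0 by rewrite mulrBl mul1r ff subrr.
clearbody k; pose Y y := f * y * k = y.
have YP x : Y (f * x * k) by rewrite /Y !mulrA ff -mulrA kk.
have YD y y' : Y y -> Y y' -> Y (y + y').
  by rewrite /Y => Yy Yy'; rewrite mulrDr mulrDl Yy Yy'.
have YM y y' : Y y -> Y y' -> Y (y * h * y').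
  by move=> <- <-; have := YP (y * k * h * f * y'); rewrite !mulrA.
have Y0 y : Y y -> y * h * y = 0.
  move=> Yy; apply: h_nil; rewrite -Yy !mulrA -(mulrA (f * y)) kf.
  by rewrite mulr0 !mul0r.
have YC y y' : Y y -> Y y' -> y * h * y' = - (y' * h * y).
  move=> Yy Yy'; apply/eqP; rewrite -addr_eq0; apply/eqP.
  have := Y0 _ (YD _ _ Yy Yy').
  by rewrite mulrDl mulrDl !mulrDr !Y0 // addr0 add0r.
have Y3 y y' y'' : Y y -> Y y' -> Y y'' -> y * h * (y' * h * y'') = 0.
  move=> Yy Yy' Yy''; apply: two_reg; rewrite mulr2n.
  rewrite {1}(YC y) //; last exact: YM.
  rewrite -!mulrA (mulrA y'') (YC y'') // !mulrN opprK !mulrA (YC y') //.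
  by rewrite !mulNr addNr.
have [//|z0] := eqVneq (k * h * f) 0.
have f0 : f <> 0 by move=> f0; rewrite f0 mulr0 eqxx in z0.
have k0 : k <> 0 by move=> k0; rewrite k0 !mul0r eqxx in z0.
(* Primeness cancels in turn [f], [k h f] and [k] from the vanishing triple products. *)
have zz x' x'' : (k * h * f) * x' * ((k * h * f) * x'' * k) = 0.
  have /A_prime[] // : forall x,
      f * x * ((k * h * f) * x' * ((k * h * f) * x'' * k)) = 0.
  by move=> x; have := Y3 _ _ _ (YP x) (YP x') (YP x''); rewrite !mulrA.
have zk x'' : (k * h * f) * x'' * k = 0.
  by case: (A_prime _ _ (fun x' => zz x' x'')) => // /eqP; rewrite (negbTE z0).
by case: (A_prime _ _ zk).
Qed.

(** Applying [corner_idem0] to [f] and to [1 - f] kills both off-diagonal corners of [h]. *)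
Lemma comm_idem (A : nzRingType) (h f : A) :
    prime_ring A -> (forall x : A, x *+ 2 = 0 -> x = 0) ->
    (forall a, a * a = 0 -> a * h * a = 0) -> f * f = f ->
  h * f = f * h.
Proof.
move=> A_prime two_reg h_nil ff.
have := corner_idem0 A_prime two_reg h_nil ff.
have := corner_idem0 A_prime two_reg h_nil (idemC ff).
rewrite subKr mulrBr mulr1 => /subr0_eq ->.
by rewrite mulrBl mul1r mulrBl => /subr0_eq ->.
Qed.

(** * Minimal projections and their corners *)

(** As in Schur's lemma, right multiplication by a nonzero self-adjoint [s] in [I] is bijective on
    [I]. The preimage [f] of [s] is the projection; a nonzero [f y f] generates [I], hence has [f]
    as a left multiple. *)
Lemma minimal_left_ideal_proj (R : realType) (A : cstarAlgType R) (I : set A) :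
    minimal_left_ideal I ->
  exists p : A, [/\ p <> 0, p^star = p, p * p = p &
    forall x, p * x * p <> 0 -> exists c, c * (p * x * p) = p].
Proof.
move=> [[I0 ID IM] I_neq0 I_min].
have [x [Ix x0]] : exists x, I x /\ x <> 0.
  apply: contra_notP I_neq0 => noI; apply/seteqP; split=> [x Ix|x ->] //=.
  by apply: contra_notP noI => x0; exists x.
pose s := x^star * x.
have s0 : s <> 0 by move/star_mul_eq0.
have Is : I s by exact: IM.
have ss : s^star = s by rewrite starM starK.
have gen y : I y -> y <> 0 -> principal_left_ideal y = I.
  move=> Iy y0.
  have idealy : left_ideal (principal_left_ideal y).
    split=> [|_ _ [a _ <-] [b _ <-]|a _ [b _ <-]] /=.
    - by exists 0; rewrite ?mul0r.
    - by exists (a + b); rewrite ?mulrDl.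
    - by exists (a * b); rewrite ?mulrA.
  case: (I_min _ idealy) => [_ [a _ <-]|y_eq0|//]; first exact: IM.
  have : [set 0] y by rewrite -y_eq0; exists 1; rewrite ?mul1r.
  by move/y0.
(* The image [I s] contains [s^2], nonzero because [s] is self-adjoint, so it is all of [I]. *)
have [f If fs] : exists2 f, I f & f * s = s.
  have : I s by [].
  have ss0 : s * s <> 0 by rewrite -{1}ss => /star_mul_eq0.
  pose J := [set y * s | y in I].
  have idealJ : left_ideal J.
    split=> [|_ _ [a Ia <-] [b Ib <-]|a _ [b Ib <-]] /=.
    - by exists 0; rewrite ?mul0r.
    - by exists (a + b); rewrite ?mulrDl //; exact: ID.
    - by exists (a * b); rewrite ?mulrA //; exact: IM.
  case: (I_min _ idealJ) => [_ [a Ia <-]|J0|JI].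
  - exact: IM.
  - have : [set 0] (s * s) by rewrite -J0; exists s.
    by move/ss0.
  - by rewrite -{1}JI => -[f If fs]; exists f.
have ann y : I y -> y * s = 0 -> y = 0.
  pose J := [set y | I y /\ y * s = 0].
  have idealJ : left_ideal J.
    split=> [|a b [Ia as0] [Ib bs0]|a b [Ib bs0]] /=.
    - by rewrite /J /= mul0r.
    - by rewrite /J /= mulrDl as0 bs0 addr0; split=> //; exact: ID.
    - by rewrite /J /= -mulrA bs0 mulr0; split=> //; exact: IM.
  move=> Iy ys; case: (I_min _ idealJ) => [a []//|J0|JI].
  - by have : [set 0] y by rewrite -J0.
  - have [_ ss0] : J s by rewrite JI.
    by case: s0; apply: star_mul_eq0; rewrite ss.
have sf : s * f = s.
  apply/subr0_eq/ann; last by rewrite mulrBl -mulrA fs subrr.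
  by rewrite -mulN1r; apply: ID; apply: IM.
(* Right multiplication by [s], injective on [I], sends both sides to [s]; self-adjointness of [f]
   follows. *)
have fE : f^star * f = f.
  apply/subr0_eq/ann; first by rewrite -mulN1r; apply: ID; apply: IM.
  by rewrite mulrBl -mulrA fs -{1}ss -starM sf ss subrr.
have fsa : f^star = f by rewrite -fE starM starK.
have ff : f * f = f by rewrite -{1}fsa.
exists f; split=> // [f0|y fyf]; first by apply: s0; rewrite -fs f0 mul0r.
have : I f by [].
by rewrite -(gen _ (IM (f * y) _ If) fyf) => -[c _ cf]; exists c.
Qed.

(** After scaling to norm 1, [p - g^2] cannot be invertible in the division algebra [p A p], so
    [(p + g)(p - g) = 0] and [g] is [p] or [-p]. *)
Lemma corner_sa_scalar (R : realType) (A : cstarAlgType R) (p g : A) :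
    p^star = p -> p * p = p ->
    (forall x, p * x * p <> 0 -> exists c, c * (p * x * p) = p) ->
    p * g = g -> g * p = g -> g^star = g ->
  exists r : R, g = r%:C *: p.
Proof.
move=> ps pp p_div.
wlog g1 : g / cnorm g = 1 => [WL|] pg gp sg.
  have [->|g0] := eqVneq g 0; first by exists 0; rewrite scale0r.
  have n0 := cnorm_gt0 g0; set n := cnorm g in n0.
  have nn : n%:C * n^-1%:C = 1 :> R[i] by rewrite -rmorphM mulfV // gt_eqF.
  case: (WL (n^-1%:C *: g)) => [||||r rE].
  - by rewrite cnormZ normcR_ge0 ?invr_ge0 ?ltW // mulVf // gt_eqF.
  - by rewrite -scalerAr pg.
  - by rewrite -scalerAl gp.
  - by rewrite starZR sg.
  - exists (n * r); rewrite rmorphM -scalerA -rE scalerA nn.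
    by rewrite scale1r.
have cornerP y : p * y = y -> y * p = y -> p * y * p = y by move=> -> ->.
have g2 : p - g * g = 0.
  apply: contrapT => pg2.
  have pEl : p * (p - g * g) = p - g * g by rewrite mulrBr pp mulrA pg.
  have pEr : (p - g * g) * p = p - g * g by rewrite mulrBl pp -mulrA gp.
  have := p_div (p - g * g); rewrite cornerP // => /(_ pg2)[c cE].
  (* A left inverse of [p - g^2] in the corner, completed by [1 - p], is one of [1 - g^2]. *)
  apply: (@sa_not_linv _ _ g (p * c * p + (1 - p))) => //.
  rewrite expr2 mulrDl [X in X + _]mulrBr [X in _ + X]mulrBr !mulr1.
  rewrite !mulrA [(1 - p) * g]mulrBl mul1r pg subrr mul0r subr0.
  rewrite -(mulrA (p * c) p g) pg -!mulrA -!mulrBr cE pp.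
  by rewrite addrC subrK.
have [pg0|pg0] := EM (p + g = 0).
  exists (-1); rewrite rmorphN1 scaleN1r; apply/eqP.
  by rewrite -addr_eq0 addrC pg0.
have := p_div (p + g); rewrite cornerP ?mulrDl ?mulrDr ?pp ?pg ?gp //.
case=> // c cE; exists 1; rewrite scale1r; apply/esym/subr0_eq.
have -> : p - g = c * (p + g) * (p - g) by rewrite cE mulrBr pp pg.
rewrite -mulrA mulrDl !mulrBr pp pg gp addrA addrNK.
by rewrite g2 mulr0.
Qed.

(** The self-adjoint elements [a + a^star] and [i(a - a^star)] are real multiples of [p], and they
    span [a]. *)
Lemma corner_scalar (R : realType) (A : cstarAlgType R) (p x : A) :
    p^star = p -> p * p = p ->
    (forall x, p * x * p <> 0 -> exists c, c * (p * x * p) = p) ->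
  exists c : R[i], p * x * p = c *: p.
Proof.
move=> ps pp p_div; set a := p * x * p.
have pa : p * a = a by rewrite /a !mulrA pp.
have ap : a * p = a by rewrite /a -mulrA pp.
have pas : p * a^star = a^star by rewrite -{1}ps -starM ap.
have asp : a^star * p = a^star by rewrite -{1}ps -starM pa.
have [r rE] : exists r : R, a + a^star = r%:C *: p.
  by apply: corner_sa_scalar; rewrite ?mulrDl ?mulrDr ?pa ?ap ?pas ?asp //
    starD starK addrC.
have [t tE] : exists r : R, 'i%C *: (a - a^star) = r%:C *: p.
  apply: corner_sa_scalar => //.
  - by rewrite -scalerAr mulrBr pa pas.
  - by rewrite -scalerAl mulrBl ap asp.
  - by rewrite starI starB starK -scalerN opprB.
exists (2%:R^-1 * (r%:C - 'i%C * t%:C)).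
rewrite -scalerA scalerBl -scalerA -rE -tE scalerA.
have -> : 'i%C * 'i%C = -1 :> R[i] by rewrite -expr2 sqr_i.
rewrite scaleN1r opprK addrACA subrr addr0 -mulr2n -[a *+ 2]scaler_nat scalerA.
by rewrite mulVf ?scale1r ?pnatr_eq0.
Qed.

(** * The diamond order *)

Lemma principal_right_ideal_sub (A : nzRingType) (a b : A) :
  (exists c, a = b * c) <->
  (principal_right_ideal a `<=` principal_right_ideal b)%classic.
Proof.
split=> [[c ->] _ [x _ <-]|ab]; first by exists (c * x); rewrite ?mulrA.
by have [|c _ <-] := ab a; [exists 1; rewrite ?mulr1|exists c].
Qed.

Lemma principal_left_ideal_sub (A : nzRingType) (a b : A) :
  (exists c, a = c * b) <->
  (principal_left_ideal a `<=` principal_left_ideal b)%classic.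
Proof.
split=> [[c ->] _ [x _ <-]|ab]; first by exists (x * c); rewrite ?mulrA.
by have [|c _ <-] := ab a; [exists 1; rewrite ?mul1r|exists c].
Qed.

Lemma diamond_le_star (R : realType) (A : cstarAlgType R) (a b : A) :
  diamond_le a b -> diamond_le a^star b^star.
Proof.
case=> /principal_right_ideal_sub[c ac] /principal_left_ideal_sub[d ad] aba.
split.
- by apply/principal_right_ideal_sub; exists d^star; rewrite -starM -ad.
- by apply/principal_left_ideal_sub; exists c^star; rewrite -starM -ac.
- have := congr1 (@star _ _) aba; rewrite !starM !starK.
  by rewrite !mulrA.
Qed.

Lemma diamond_le_unit (R : realType) (A : cstarAlgType R) (a b c d : A) :
    c * b = 1 -> b * d = 1 -> a * a^star * a = a * b^star * a ->
  diamond_le a b.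
Proof.
move=> cb bd aba; split=> //.
- by apply/principal_right_ideal_sub; exists (d * a); rewrite mulrA bd mul1r.
- by apply/principal_left_ideal_sub; exists (a * c); rewrite -mulrA cb mulr1.
Qed.

(** The inverse of [a - 1] is [-(a + 1)], which gives both inclusions; the [1] in [(a - 1)^star]
    contributes only [a^2 = 0]. *)
Lemma sqr0_diamond_le (R : realType) (A : cstarAlgType R) (a : A) :
  a * a = 0 -> diamond_le a (a - 1).
Proof.
move=> aa; have inv : (a - 1) * (- (a + 1)) = 1.
  rewrite mulrN mulrDr mulr1 mulrBl aa mul1r sub0r addrA addNr sub0r.
  by rewrite opprK.
have inv' : - (a + 1) * (a - 1) = 1.
  rewrite mulNr mulrDl mul1r mulrBr aa mulr1 sub0r addrA addNr sub0r.
  by rewrite opprK.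
apply: diamond_le_unit inv' inv _.
by rewrite starB star1 mulrBr mulr1 mulrBl aa subr0.
Qed.

(* With [h = u u^*], the relation [a u <= (a - 1) u] cancels to [a h a = 0]. *)
Lemma sqr0_mul_star (R : realType) (A : cstarAlgType R) (u : A) :
    (forall x, x * u = 0 -> x = 0) ->
    (forall a b : A, diamond_le a b -> diamond_le (a * u) (b * u)) ->
  forall a, a * a = 0 -> a * (u * u^star) * a = 0.
Proof.
move=> u_inj u_homo a aa; apply: u_inj.
have [_ _] := u_homo _ _ (sqr0_diamond_le aa).
rewrite mulrBl mul1r starB mulrBr mulrBl => /eqP.
by rewrite eq_sym -subr_eq0 addrAC subrr sub0r oppr_eq0 !mulrA => /eqP.
Qed.

(* If [l < 0] then [y = p u (1 - p)] satisfies [y^2 = 0] and [y y^* = - k p]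
   with [k > 0], so [z = sqrt k p + y^*] is a nonzero null vector, [z^* z = 0]. *)
Lemma mul_star_scalar_ge0 (R : realType) (A : cstarAlgType R) (p u : A)
    (l : R) :
    p <> 0 -> p^star = p -> p * p = p ->
    (exists c : R[i], p * u * p = c *: p) -> u * u^star = l%:C%:A ->
  0 <= l.
Proof.
move=> p0 ps pp [c cE] uu; rewrite leNgt; apply/negP => l0.
(* [k] comes from [y y^star = p u u^star p - (p u p)(p u p)^star = (l - |c|^2) p]. *)
pose y := p * u * (1 - p); pose k : R := Normc.normc c ^+ 2 - l.
have yp : y * p = 0 by rewrite /y -mulrA mulrBl mul1r pp subrr mulr0.
have py : p * y = y by rewrite /y !mulrA pp.
have pys : p * y^star = 0 by rewrite -{1}ps -starM yp star0.
have k0 : 0 < k by rewrite subr_gt0 (lt_le_trans l0) ?sqr_ge0.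
have yE : y = p * u - c *: p by rewrite /y mulrBr mulr1 cE.
have yy : y * y^star = - (k%:C *: p).
  rewrite {2}yE starB starZ mulrBr -scalerAr ps yp scaler0 subr0 starM ps.
  rewrite yE mulrBl mulrA -(mulrA p) uu -scalerAr mulr1 -scalerAl pp.
  rewrite -scalerAl -{2}pp.
  have -> : p * p * (u^star * p) = (p * u * p)^star.
    by rewrite pp !starM ps.
  rewrite cE starZ ps scalerA -scalerBl -[RHS]scaleNr; congr (_ *: _).
  rewrite /k rmorphB opprB; congr (_ - _).
  by rewrite -sqr_normc rmorphXn.
pose s : R := Num.sqrt k; have ss : s%:C * s%:C = k%:C.
  by rewrite -rmorphM -expr2 sqr_sqrtr // ltW.
have z0 : s%:C *: p + y^star = 0.
  apply: star_mul_eq0; rewrite starD starZR ps starK mulrDl !mulrDr.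
  rewrite -!scalerAl -!scalerAr pp yp pys yy scalerA ss !scaler0 addr0 add0r.
  by rewrite subrr.
have : s%:C *: p = 0.
  by rewrite -{1}pp scalerAr -[LHS]addr0 -pys -mulrDr z0 mulr0.
move=> sp0; apply: p0; apply: cnorm0_eq0; apply/eqP.
have /eqP := congr1 (@cnorm _ _) sp0.
rewrite cnorm0 cnormZ normcR_ge0 ?sqrtr_ge0 // mulf_eq0.
by rewrite sqrtr_eq0 leNgt k0.
Qed.

(** * Scalarity of [u u^star] and of [u^star u] *)

Lemma mul_star_scalar (R : realType) (A : cstarAlgType R) (u : A)
    (A_prime : prime_ring A) (socle_neq0 : socle A <> [set 0]) :
    (forall a b : A, diamond_le a b <-> diamond_le (a * u) (b * u)) ->
  exists lambda : R, 0 < lambda /\ u * u^star = lambda%:C%:A.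
Proof.
move=> u_mono.
(* If [x u = 0] then [x u] lies below [0 u], so [x] lies below 0. *)
have u_inj x : x * u = 0 -> x = 0.
  move=> xu; have [] := (u_mono x 0).2.
    by rewrite xu mul0r; split; rewrite ?mul0r.
  by move=> /principal_right_ideal_sub[c ->]; rewrite mul0r.
(* Without minimal left ideals only the empty sum is left, and the socle is [0]. *)
have [I Imin] : exists I : set A, minimal_left_ideal I.
  apply: contra_notP socle_neq0 => noI; apply/seteqP; split=> x /=.
    case=> [[|n] [I [y [Iy ->]]]]; first by rewrite big_ord0.
    by case: noI; exists (I ord0); case: (Iy ord0).
  move=> ->; exists 0, (fun=> set0), (fun=> 0); split; first by case.
  by rewrite big_ord0.
have [p [p0 ps pp p_div]] := minimal_left_ideal_proj Imin.
set h := u * u^star.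
have sh : h^star = h by rewrite starM starK.
have two_reg (x : A) : x *+ 2 = 0 -> x = 0.
  move=> x2; apply: cnorm0_eq0; apply/eqP.
  by have /eqP := congr1 (@cnorm _ _) x2; rewrite cnormMn cnorm0 mulrn_eq0.
have hC f : f * f = f -> h * f = f * h.
  by apply: comm_idem => //; apply: sqr0_mul_star => // a b /u_mono.
have hp := hC p pp.
have [l lE] : exists l : R, h * p = l%:C *: p.
  apply: corner_sa_scalar => //.
  - by rewrite mulrA -hp -mulrA pp.
  - by rewrite -mulrA pp.
  - by rewrite starM ps sh hp.
have hE : h = l%:C%:A.
  pose d := h - l%:C%:A.
  have dp : d * p = 0 by rewrite mulrBl lE -scalerAl mul1r subrr.
  have dxp x : d * x * p = 0.
    (* As [p + v] is idempotent, [h] commutes with it, hence with [v]; then [d] kills both parts of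
       [x p = v + p x p]. *)
    pose v := (1 - p) * x * p.
    have pv : p * v = 0 by rewrite /v !mulrA mulrBr mulr1 pp subrr !mul0r.
    have vp : v * p = v by rewrite /v -mulrA pp.
    have vv : v * v = 0 by rewrite -{1}vp -mulrA pv mulr0.
    have hv : h * v = v * h.
      have : (p + v) * (p + v) = p + v.
        by rewrite mulrDl !mulrDr pp pv vp vv !addr0.
      by move/hC; rewrite mulrDl mulrDr hp => /addrI.
    have dv : d * v = 0.
      rewrite mulrBl hv -scalerAl mul1r -{1}vp -mulrA -hp lE.
      by rewrite -scalerAr vp subrr.
    have xpE : x * p = v + p * (x * p).
      by rewrite /v -mulrA mulrBl mul1r subrK.
    by rewrite -mulrA xpE mulrDr dv mulrA dp mul0r addr0.
  by apply: subr0_eq; case: (A_prime _ _ dxp).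
exists l; split=> //; rewrite lt_def.
rewrite (mul_star_scalar_ge0 p0 ps pp (corner_scalar u ps pp p_div) hE) andbT.
apply/eqP => l0; have u0 : u = 0.
  by apply: mul_star_eq0; rewrite -/h hE l0 scale0r.
have /u_inj/eqP : 1 * u = 0 by rewrite u0 mulr0.
by rewrite oner_eq0.
Qed.

Theorem proposition2p9 (R : realType) (A : cstarAlgType R) (u : A)
    (A_prime : prime_ring A) (socle_neq0 : socle A <> [set 0])
    (u_regular : vN_regular u) :
  ((forall a b : A, diamond_le a b <-> diamond_le (a * u) (b * u)) ->
     exists lambda : R, 0 < lambda /\ u * u^star = (lambda%:C)%:A) /\
  ((forall a b : A, diamond_le a b <-> diamond_le (u * a) (u * b)) ->
     exists lambda : R, 0 < lambda /\ u^star * u = (lambda%:C)%:A).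
Proof.
split=> [|u_mono]; first exact: mul_star_scalar.
(* The involution preserves the order and turns left multiplication by [u] into right multiplication
   by [u^star]. *)
have leE (a b : A) : diamond_le a b <-> diamond_le a^star b^star.
  by split=> /diamond_le_star //; rewrite !starK.
rewrite -{2}(starK u); apply: mul_star_scalar => // a b.
by rewrite leE u_mono leE !starM !starK.
Qed.
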